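(* Let $n\geq2$ and let $\alpha=\sum_{i=1}^Mr_i[(u_i,v_i)]\in\mathbb Z[\widetilde S_1\times\widetilde S_1]$. The 1-form $$w_n(\alpha)=\sum_{i=1}^Mr_iu_i^{n-2}(u_i\,dv_i-v_i\,du_i)$$ vanishes in $\Omega^1_{n-1}(\widetilde S)$ if and only if the element $$A=\sum_{i=1}^Mr_i(z_i\wedge w_i)\otimes z_i^{n-2}\in\wedge^2(U)\otimes\mathrm{Sym}^{n-2}(U)$$ has order $1$ or $2$.
   Context: $\widetilde S=\mathbb Z[\widetilde a_1,\widetilde a_2,\dots]$ is a polynomial ring in formal variables, $\widetilde S_k\subset\widetilde S$ is the group of homogeneous polynomials of degree $k$, and $\Omega^1_k(\widetilde S)$ is the group of 1-forms of degree $k$, i.e. finite sums of terms $f\,d\widetilde a_i$ with $f\in\widetilde S_k$. $U$ is the free (multiplicatively written) abelian group on symbols $a_1,a_2,\dots$, and $\pi:\widetilde S_1\to U$ is the homomorphism $\widetilde a_i\mapsto a_i$. For $\alpha=\sum_i r_i[(u_i,v_i)]$ with $r_i\in\mathbb Z$, $u_i,v_i\in\widetilde S_1$, put $z_i=\pi(u_i)$, $w_i=\pi(v_i)$. All tensor, exterior and symmetric powers are over $\mathbb Z$; $\wedge^2(A)$ is the quotient of $A\otimes A$ by the relations $a\otimes b+b\otimes a$ (so $a\wedge a$ is 2-torsion but not assumed zero). *)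

(* Defs.v *)
From HB Require Import structures.
From mathcomp Require Import all_boot all_order all_fingroup all_algebra.
From mathcomp Require Import finmap boolp.
From mathcomp.multinomials Require Import monalg.

Set Implicit Arguments.
Unset Strict Implicit.
Unset Printing Implicit Defensive.

Import GRing.Theory.
Local Open Scope ring_scope.

(* [{malg K}], i.e. [{malg int[K]}], is used as the free abelian group Z[K] on
   the set K, with << r *g k >> for r[k]; [lin_ext h] is the homomorphism
   Z[K] -> V induced by h. *)

Section LinearExtension.
Variables (K : choiceType) (V : zmodType) (h : K -> V).

Definition lin_ext (g : {malg K}) : V := \sum_(k <- msupp g) h k *~ g@_k.

Lemma lin_extEw (d : {fset K}) (g : {malg K}) :
  (msupp g `<=` d)%fset -> lin_ext g = \sum_(k <- d) h k *~ g@_k.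
Proof.
move=> sd; rewrite /lin_ext (big_fset_incl _ sd) // => k _ kNg.
by rewrite mcoeff_outdom // mulr0z.
Qed.

Fact lin_ext_is_zmod_morphism : zmod_morphism lin_ext.
Proof.
move=> f g.
rewrite (lin_extEw (fsubsetUl (msupp f) (msupp g))).
rewrite (lin_extEw (fsubsetUr (msupp f) (msupp g))).
rewrite (lin_extEw (msuppB_le f g)) -sumrB.
by apply: eq_bigr => k _; rewrite mcoeffB mulrzBr.
Qed.

HB.instance Definition _ :=
  GRing.isZmodMorphism.Build {malg K} V lin_ext lin_ext_is_zmod_morphism.

Lemma lin_extU (r : int) (k : K) : lin_ext << r *g k >> = h k *~ r.
Proof.
by rewrite (lin_extEw (@msuppU_le _ _ k r)) big_seq_fset1 mcoeffUU.
Qed.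

End LinearExtension.

Inductive zspan (V : zmodType) (R : V -> Prop) : V -> Prop :=
| zspan_rel x of R x : zspan R x
| zspan_zero : zspan R 0
| zspan_sub x y of zspan R x & zspan R y : zspan R (x - y).

Definition in_zspan (V : zmodType) (R : V -> Prop) : pred V :=
  fun x => `[< zspan R x >].

Fact in_zspan_zmod_closed (V : zmodType) (R : V -> Prop) :
  zmod_closed (in_zspan R).
Proof.
split; first exact/asboolP/zspan_zero.
by move=> x y /asboolP Rx /asboolP Ry; apply/asboolP/zspan_sub.
Qed.

HB.instance Definition _ (V : zmodType) (R : V -> Prop) :=
  GRing.isZmodClosed.Build V (in_zspan R) (in_zspan_zmod_closed R).

Definition zspanned (V : zmodType) (R : V -> Prop) : zmodClosed V :=
  GRing.ZmodClosed.clone V (in_zspan R) _.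

Definition quot_by (V : zmodType) (R : V -> Prop) : zmodType :=
  Quotient.quot (zspanned R).

Definition quot_class (V : zmodType) (R : V -> Prop) (x : V) : quot_by R :=
  \pi_(Quotient.quot (zspanned R))%qT x.

Lemma quot_class_eq0 (V : zmodType) (R : V -> Prop) (x : V) :
  quot_class R x = 0 <-> zspan R x.
Proof.
have E : in_zspan R x = (quot_class R x == 0).
  have := Quotient.idealrBE (zspanned R) x 0.
  by rewrite subr0 /quot_class raddf0.
by split=> [/eqP|/asboolP H]; [rewrite -E => /asboolP | apply/eqP; rewrite -E].
Qed.

Inductive tensor_rel (A B : zmodType) : {malg (A * B)%type} -> Prop :=
| tensor_relDl a a' b :
    tensor_rel (<< (a + a', b) >> - << (a, b) >> - << (a', b) >>)
| tensor_relDr a b b' :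
    tensor_rel (<< (a, b + b') >> - << (a, b) >> - << (a, b') >>).

Definition tensor (A B : zmodType) : zmodType := quot_by (@tensor_rel A B).

Definition tens (A B : zmodType) (a : A) (b : B) : tensor A B :=
  quot_class (@tensor_rel A B) << (a, b) >>.

Notation "a ⊗ b" := (tens a b)
  (at level 40, left associativity) : ring_scope.

(* Only antisymmetry is imposed: a ∧ a is killed by 2, but need not vanish. *)
Inductive wedge2_rel (A : zmodType) : tensor A A -> Prop :=
| Wedge2Rel a b : wedge2_rel (a ⊗ b + b ⊗ a).

Definition wedge2 (A : zmodType) : zmodType := quot_by (@wedge2_rel A).

Definition wedge (A : zmodType) (a b : A) : wedge2 A :=
  quot_class (@wedge2_rel A) (a ⊗ b).

Notation "a ∧ b" := (wedge a b)
  (at level 40, left associativity) : ring_scope.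

(* Additivity in the i-th slot, the other slots being fixed.  For k = 0 there
   is no relation and the 0-th tensor power is Z. *)
Inductive tpower_rel (k : nat) (A : zmodType) :
    {malg {ffun 'I_k -> A}} -> Prop :=
| TpowerRel (i : 'I_k) (f g h : {ffun 'I_k -> A}) of
    f i = g i + h i
  & (forall j, j != i -> f j = g j)
  & (forall j, j != i -> f j = h j) :
    tpower_rel (<< f >> - << g >> - << h >>).

Definition tpower (k : nat) (A : zmodType) : zmodType :=
  quot_by (@tpower_rel k A).

Definition tpure (k : nat) (A : zmodType) (f : {ffun 'I_k -> A}) :
    tpower k A :=
  quot_class (@tpower_rel k A) << f >>.

Inductive sym_rel (k : nat) (A : zmodType) : tpower k A -> Prop :=
| SymRel (s : 'S_k) (f : {ffun 'I_k -> A}) :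
    sym_rel (tpure [ffun i => f (s i)] - tpure f).

Definition Sym (k : nat) (A : zmodType) : zmodType := quot_by (@sym_rel k A).

Definition sym_prod (k : nat) (A : zmodType) (f : {ffun 'I_k -> A}) :
    Sym k A :=
  quot_class (@sym_rel k A) (tpure f).

Definition sym_pow (A : zmodType) (a : A) (k : nat) : Sym k A :=
  sym_prod [ffun _ : 'I_k => a].

(* The variables are indexed by [nat], hence from 0 rather than from 1. *)

Definition Stilde := {malg int[{cmonom nat}]}.
HB.instance Definition _ := GRing.ComNzRing.on Stilde.

Definition avar (i : nat) : Stilde := << ucm i >>.

Definition homog (k : nat) : pred Stilde :=
  fun f => all (fun m => mdeg m == k) (msupp f).

Lemma homogP (k : nat) (f : Stilde) :
  reflect (forall m, f@_m != 0 -> mdeg m = k) (f \in homog k).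
Proof.
apply: (iffP allP) => [H m|H m].
  by rewrite mcoeff_neq0 => /H /eqP.
by rewrite -mcoeff_neq0 => /H /eqP.
Qed.

Fact homog_zmod_closed (k : nat) : zmod_closed (homog k).
Proof.
split; first by apply/homogP => m; rewrite mcoeff0 eqxx.
move=> f g /homogP Hf /homogP Hg; apply/homogP => m; rewrite mcoeffB.
have [->|/Hf //] := eqVneq f@_m 0; rewrite sub0r oppr_eq0; exact: Hg.
Qed.

HB.instance Definition _ (k : nat) :=
  GRing.isZmodClosed.Build Stilde (homog k) (homog_zmod_closed k).

Lemma homogM (j k : nat) (f g : Stilde) :
  f \in homog j -> g \in homog k -> f * g \in homog (j + k).
Proof.
move=> /allP Hf /allP Hg; apply/allP => m /msuppM_le [m1 [m2 [m1f m2g ->]]].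
by rewrite mdegM (eqP (Hf _ m1f)) (eqP (Hg _ m2g)).
Qed.

Lemma homogX (j k : nat) (f : Stilde) :
  f \in homog j -> f ^+ k \in homog (k * j).
Proof.
move=> Hf; elim: k => [|k IHk]; last by rewrite exprS mulSn homogM.
apply/homogP => m; rewrite expr0 mcoeff1; have [->|_] := eqVneq m mone.
  by rewrite mdeg1.
by rewrite eqxx.
Qed.

Record Sgraded (k : nat) := SgradedPoly {
  Sgraded_val :> Stilde;
  Sgraded_homog : Sgraded_val \in homog k
}.

HB.instance Definition _ (k : nat) := [isSub for @Sgraded_val k].
HB.instance Definition _ (k : nat) := [Choice of Sgraded k by <:].
HB.instance Definition _ (k : nat) :=
  [SubChoice_isSubZmodule of Sgraded k by <:].

(* The free [Stilde]-module on the symbols da_i. *)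
Definition Omega1 := {malg Stilde[nat]}.
HB.instance Definition _ := GRing.Lmodule.on Omega1.

Definition da (i : nat) : Omega1 := << i >>.

Record Omega1_gr (k : nat) := Omega1Form {
  Omega1_val :> Omega1;
  Omega1_homog : Omega1_val \is a monalgOver (homog k)
}.

HB.instance Definition _ (k : nat) := [isSub for @Omega1_val k].
HB.instance Definition _ (k : nat) := [Choice of Omega1_gr k by <:].
HB.instance Definition _ (k : nat) :=
  [SubChoice_isSubZmodule of Omega1_gr k by <:].

(* d(prod_i a_i^(m i)) = sum_i (m i) (prod_j a_j^(m j) / a_i) da_i *)
Definition dmonom (m : {cmonom nat}) : Omega1 :=
  \sum_(i <- finsupp m) (<< (m i)%:Z *g divcm m (ucm i) >> : Stilde) *: da i.

Definition dform (f : Stilde) : Omega1 := lin_ext dmonom f.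

Lemma dform_avar (i : nat) : dform (avar i) = da i.
Proof.
rewrite /dform /avar lin_extU mulr1z /dmonom mdomU big_seq_fset1 cmUU.
suff -> : divcm (ucm i) (ucm i) = mone by rewrite scale1r.
by apply/eqP/cmP => j; rewrite divcmE subnn cm1.
Qed.

Lemma dmonom_homog (k : nat) (m : {cmonom nat}) :
  mdeg m = k.+1 -> dmonom m \is a monalgOver (homog k).
Proof.
move=> mk; apply/monalgOverP => j; rewrite raddf_sum big_seq rpred_sum //= => i im.
rewrite mcoeffZ /da mcoeffU mulrnAr mulr1 rpredMn //.
apply/homogP => m'; rewrite mcoeffU; have [<- _|_] := eqVneq (divcm m (ucm i)) m'; last first.
  by rewrite mulr0n eqxx.
have mE : m = mmul (divcm m (ucm i)) (ucm i).
  apply/eqP/cmP => l; rewrite cmM divcmE cmU; case: eqP => [<-|_]; last first.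
    by rewrite subn0 addn0.
  by rewrite subnK // lt0n cmE_neq0.
by move: mk; rewrite {1}mE mdegM mdegU addn1 => -[].
Qed.

Lemma dform_homog (k : nat) (f : Stilde) :
  f \in homog k.+1 -> dform f \is a monalgOver (homog k).
Proof.
move=> /homogP fk; rewrite /dform /lin_ext big_seq rpred_sum //= => m mf.
by rewrite rpredMz // dmonom_homog // fk // mcoeff_neq0.
Qed.

Lemma Omega1_homogZ (j k : nat) (f : Stilde) (w : Omega1) :
    f \in homog j -> w \is a monalgOver (homog k) ->
  f *: w \is a monalgOver (homog (j + k)).
Proof.
move=> fj /monalgOverP wk; apply/monalgOverP => i.
by rewrite mcoeffZ homogM.
Qed.

(* U is written additively: [<< i >>] is the i-th generator. *)
Definition U : zmodType := {malg int[nat]}.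

Definition agen (i : nat) : U := << i >>.

(* [lin_ext] of a_i~ |-> a_i; as only the degree 1 part of [Stilde] matters,
   the value on the other monomials is irrelevant. *)
Definition piU (u : Sgraded 1) : U :=
  lin_ext (fun m : {cmonom nat} => \sum_(i <- finsupp m) agen i)
    (u : Stilde).

Fact piU_is_zmod_morphism : zmod_morphism piU.
Proof. by move=> u v; rewrite /piU raddfB. Qed.

HB.instance Definition _ :=
  GRing.isZmodMorphism.Build (Sgraded 1) U piU piU_is_zmod_morphism.

Lemma piU_avar (u : Sgraded 1) (i : nat) :
  u = avar i :> Stilde -> piU u = agen i.
Proof.
by rewrite /piU => ->; rewrite lin_extU mulr1z mdomU big_seq_fset1.
Qed.

Definition wterm (n : nat) (u v : Stilde) : Omega1 :=
  u ^+ (n - 2) *: (u *: dform v - v *: dform u).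

Fact wterm_homog (n : nat) (hn : (2 <= n)%N) (u v : Sgraded 1) :
  wterm n u v \is a monalgOver (homog (n - 1)).
Proof.
have -> : (n - 1 = (n - 2) * 1 + (1 + 0))%N.
  by case: n hn => [|[|n]] // _; rewrite !subSS !subn0 muln1 addn1.
apply: Omega1_homogZ; first exact: homogX (Sgraded_homog u).
by rewrite rpredB // Omega1_homogZ ?dform_homog ?Sgraded_homog.
Qed.

Definition wterm_gr (n : nat) (hn : (2 <= n)%N)
    (uv : (Sgraded 1 * Sgraded 1)%type) : Omega1_gr (n - 1) :=
  Omega1Form (wterm_homog hn uv.1 uv.2).

Definition wform (n : nat) (hn : (2 <= n)%N)
    (alpha : {malg (Sgraded 1 * Sgraded 1)%type}) : Omega1_gr (n - 1) :=
  lin_ext (wterm_gr hn) alpha.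

Lemma wformE (n : nat) (hn : (2 <= n)%N) (M : nat) (r : 'I_M -> int)
    (u v : 'I_M -> Sgraded 1) :
  wform hn (\sum_i << r i *g (u i, v i) >>) =
  \sum_i (u i : Stilde) ^+ (n - 2)
    *: ((u i : Stilde) *: dform (v i) - (v i : Stilde) *: dform (u i)) *~ r i
  :> Omega1.
Proof.
rewrite /wform raddf_sum -[LHS]/(val _) raddf_sum; apply: eq_bigr => i _.
by rewrite -[LHS]/(val (lin_ext _ _)) lin_extU raddfMz.
Qed.

Definition has_order (V : zmodType) (x : V) (k : nat) : Prop :=
  [/\ (0 < k)%N, x *+ k = 0
    & forall j, (0 < j)%N -> (j < k)%N -> x *+ j <> 0].

(* Main.v *)
From HB Require Import structures.
From mathcomp Require Import all_boot perm all_algebra.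
From mathcomp Require Import finmap boolp ring.
From mathcomp.multinomials Require Import monalg.
Require Import Defs.

Set Implicit Arguments.
Unset Strict Implicit.
Unset Printing Implicit Defensive.

Import GRing.Theory.
Local Open Scope ring_scope.

(** Write u and v for the linear polynomials attached to z and w, and put
    N = n - 2.  An element of order 1 or 2 is one killed by 2, so the claim is
    that the form vanishes exactly when 2 A = 0.

    The Koszul differential sends (a ∧ b) ⊗ s to s (a db - b da), and A to the
    1-form of the theorem ([koszul_map]).  As 1-forms have no torsion, 2 A = 0
    makes the form vanish.

    This differential is not injective, even rationally: for three generators
    it kills (a ∧ b) ⊗ c + (b ∧ c) ⊗ a + (c ∧ a) ⊗ b.  But A is a combination
    of the special tensors (z ∧ w) ⊗ z^N, and these are recovered by exterior
    differentiation:
      d (u^N (u dv - v du)) = (N + 2) u^N du ∧ dv = n u^N du ∧ dv,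
    because the derivative of u^N contributes only
    N u^(N-1) du ∧ (u dv - v du) = N u^N du ∧ dv, its second part containing
    du ∧ du = 0 ([curl_wterm]).  Hence if the form vanishes then, polynomials
    being torsion-free, so does the sum of the r_i u_i^N du_i ∧ dv_i, that is,
    for all j and k, the polynomial
      sum_i r_i (z_ij w_ik - z_ik w_ij) u_i^N
    vanishes, where z_ij and w_ij are the coordinates of z_i and w_i on the
    generators a_j of U ([minors_eq0]).  Reading this in Sym^N(U)
    ([sym_class]), tensoring with a_j ∧ a_k and summing over all ordered pairs
    (j, k) gives 2 A = 0, since
      2 (z ∧ w) = sum_{j,k} (z_j w_k - z_k w_j) (a_j ∧ a_k)
    ([wedge_mul2], [wedge_sym_mul2_eq0]).  The factor 2 is the effect of the
    elements a_j ∧ a_j, which have order 2 and which the minors do not see. *)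

(** * Free abelian groups *)

Lemma malgU_mulrz (K : choiceType) (c : int) (k : K) :
  << c *g k >> = << k >> *~ c :> {malg K}.
Proof. by rewrite -(raddfMz (mkmalgU k)) /= intz. Qed.

Lemma malg_expand (K : choiceType) (d : {fset K}) (g : {malg K}) :
  (msupp g `<=` d)%fset -> g = \sum_(k <- d) << k >> *~ g@_k.
Proof.
move=> sd; rewrite {1}(monalgEw sd).
by apply: eq_bigr => k _; exact: malgU_mulrz.
Qed.

Lemma malg_ind (K : choiceType) (P : {malg K} -> Prop) :
  P 0 -> (forall x y, P x -> P y -> P (x - y)) -> (forall k, P << k >>) ->
  forall g, P g.
Proof.
move=> P0 PB P1 g.
have PN x : P x -> P (- x) by move=> Px; rewrite -sub0r; exact: PB.
have PD x y : P x -> P y -> P (x + y).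
  by move=> Px Py; rewrite -[y]opprK; apply: PB => //; exact: PN.
rewrite (malg_expand (fsubset_refl (msupp g))); apply: big_ind => // k _.
have PMn m : P (<< k >> *+ m) by elim: m => // m IH; rewrite mulrS; exact: PD.
by case: (g@_k) => m; [exact: PMn | exact/PN/PMn].
Qed.

Lemma malg_ext (K : choiceType) (V : zmodType)
    (f g : {additive {malg K} -> V}) :
  (forall k, f << k >> = g << k >>) -> f =1 g.
Proof.
move=> fg; apply: malg_ind => [|x y fx fy|//]; first by rewrite !raddf0.
by rewrite !raddfB fx fy.
Qed.

Lemma malg_mulrn_eq0 (K : choiceType) (V : zmodType) (n : nat)
    (g : {malg V[K]}) :
  (forall x : V, x *+ n = 0 -> x = 0) -> g *+ n = 0 -> g = 0.
Proof.
move=> tfV gn0; apply/malgP => k; rewrite mcoeff0; apply: tfV.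
by rewrite -mcoeffMn gn0 mcoeff0.
Qed.

Lemma int_mulrn_eq0 (n : nat) (x : int) : (0 < n)%N -> x *+ n = 0 -> x = 0.
Proof.
by move=> n0 /eqP; rewrite Num.Theory.mulrn_eq0 eqn0Ngt n0 => /eqP.
Qed.

Lemma Stilde_mulrn_eq0 (n : nat) (f : Stilde) :
  (0 < n)%N -> f *+ n = 0 -> f = 0.
Proof. by move=> n0; apply: malg_mulrn_eq0 => x; exact: int_mulrn_eq0. Qed.

Lemma Omega1_mulrn_eq0 (n : nat) (o : Omega1) :
  (0 < n)%N -> o *+ n = 0 -> o = 0.
Proof. by move=> n0; apply: malg_mulrn_eq0 => x; exact: Stilde_mulrn_eq0. Qed.

(** * Quotients, tensor products and exterior squares *)

Fact quot_class_is_zmod_morphism (V : zmodType) (R : V -> Prop) :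
  zmod_morphism (quot_class R).
Proof. by move=> x y; rewrite /quot_class raddfB. Qed.

HB.instance Definition _ (V : zmodType) (R : V -> Prop) :=
  GRing.isZmodMorphism.Build V (quot_by R) (quot_class R)
    (quot_class_is_zmod_morphism R).

Lemma quot_class_rel (V : zmodType) (R : V -> Prop) (x : V) :
  R x -> quot_class R x = 0.
Proof. by move=> Rx; apply/quot_class_eq0/zspan_rel. Qed.

(** Stated as the existence of a bundled additive map, so that the lifts below
    can be iterated over the successive quotients defining a tensor power. *)
Lemma quot_lift (V W : zmodType) (R : V -> Prop) (h : {additive V -> W}) :
    (forall x, R x -> h x = 0) ->
  exists g : {additive quot_by R -> W}, forall x, g (quot_class R x) = h x.
Proof.
move=> hR.
have h0 x : quot_class R x = 0 -> h x = 0.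
  move=> /quot_class_eq0; elim=> [y /hR|//|y y' _ hy _ hy'] //.
    exact: raddf0.
  by rewrite raddfB hy hy' subr0.
pose g (q : quot_by R) : W := h (repr q).
have gE x : g (quot_class R x) = h x.
  apply/eqP; rewrite -subr_eq0 -raddfB; apply/eqP/h0.
  by rewrite raddfB /= {1}/quot_class reprK subrr.
have gA : zmod_morphism g.
  move=> x y; rewrite -[x]reprK -[y]reprK -!/(quot_class R _) -raddfB !gE.
  exact: raddfB.
pose gM := GRing.isZmodMorphism.Build _ _ g gA.
pose gadd : {additive quot_by R -> W} := HB.pack g gM.
by exists gadd.
Qed.

Lemma tensDl (A B : zmodType) (b : B) :
  {morph (fun a : A => a ⊗ b) : a a' / a + a'}.
Proof.
move=> a a' /=; apply/eqP; rewrite -subr_eq0 opprD addrA; apply/eqP.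
by rewrite /tens -!raddfB; exact/quot_class_rel/tensor_relDl.
Qed.

Lemma tensDr (A B : zmodType) (a : A) : {morph (@tens A B a) : b b' / b + b'}.
Proof.
move=> b b' /=; apply/eqP; rewrite -subr_eq0 opprD addrA; apply/eqP.
by rewrite /tens -!raddfB; exact/quot_class_rel/tensor_relDr.
Qed.

Lemma additive_of_morphD (V W : zmodType) (f : V -> W) :
  {morph f : x y / x + y} -> zmod_morphism f.
Proof.
by move=> fD x y; apply/eqP; rewrite eq_sym subr_eq -fD subrK.
Qed.

HB.instance Definition _ (A B : zmodType) (a : A) :=
  GRing.isZmodMorphism.Build B (tensor A B) (tens a)
    (additive_of_morphD (tensDr a)).

(** The name makes the left slot a head symbol, to which the additive
    structure can be attached. *)
Definition tensl (A B : zmodType) (b : B) (a : A) : tensor A B := a ⊗ b.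

HB.instance Definition _ (A B : zmodType) (b : B) :=
  GRing.isZmodMorphism.Build A (tensor A B) (@tensl A B b)
    (additive_of_morphD (@tensDl A B b)).

Lemma tensor_lift (A B V : zmodType) (beta : A -> B -> V) :
    (forall b, {morph beta^~ b : a a' / a + a'}) ->
    (forall a, {morph beta a : b b' / b + b'}) ->
  exists g : {additive tensor A B -> V}, forall a b, g (a ⊗ b) = beta a b.
Proof.
move=> bDl bDr.
have [|g gE] := @quot_lift _ V (@tensor_rel A B)
    (lin_ext (fun ab : A * B => beta ab.1 ab.2)).
  by move=> _ [a a' b|a b b']; rewrite !raddfB /= !lin_extU !mulr1z /=
    -addrA -opprD ?bDl ?bDr subrr.
by exists g => a b; rewrite /tens gE /= lin_extU.
Qed.

Lemma wedgeDl (A : zmodType) (b : A) :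
  {morph (fun a : A => a ∧ b) : a a' / a + a'}.
Proof. by move=> a a' /=; rewrite /wedge tensDl raddfD. Qed.

Lemma wedgeDr (A : zmodType) (a : A) : {morph (@wedge A a) : b b' / b + b'}.
Proof. by move=> b b' /=; rewrite /wedge tensDr raddfD. Qed.

Lemma wedgeC (A : zmodType) (a b : A) : b ∧ a = - (a ∧ b).
Proof.
apply/eqP; rewrite -addr_eq0 /wedge -raddfD.
by apply/eqP/quot_class_rel/Wedge2Rel.
Qed.

HB.instance Definition _ (A : zmodType) (a : A) :=
  GRing.isZmodMorphism.Build A (wedge2 A) (wedge a)
    (additive_of_morphD (wedgeDr a)).

(** As [tensl], for the left slot of the exterior product. *)
Definition wedgel (A : zmodType) (b a : A) : wedge2 A := a ∧ b.

HB.instance Definition _ (A : zmodType) (b : A) :=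
  GRing.isZmodMorphism.Build A (wedge2 A) (@wedgel A b)
    (additive_of_morphD (@wedgeDl A b)).

Lemma wedge2_lift (A V : zmodType) (beta : A -> A -> V) :
    (forall b, {morph beta^~ b : a a' / a + a'}) ->
    (forall a b, beta b a = - beta a b) ->
  exists g : {additive wedge2 A -> V}, forall a b, g (a ∧ b) = beta a b.
Proof.
move=> bDl bC.
have bDr a : {morph beta a : b b' / b + b'}.
  by move=> b b'; rewrite ![beta a _]bC bDl opprD.
have [h hE] := tensor_lift bDl bDr.
have [|g gE] := @quot_lift _ V (@wedge2_rel A) h.
  by move=> _ [a b]; rewrite raddfD /= !hE bC addNr.
by exists g => a b; rewrite /wedge gE hE.
Qed.

(** * Symmetric powers *)

Definition slot_additive (k : nat) (A V : zmodType)
    (P : {ffun 'I_k -> A} -> V) : Prop :=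
  forall (i : 'I_k) (f g h : {ffun 'I_k -> A}),
    f i = g i + h i -> (forall j, j != i -> f j = g j) ->
    (forall j, j != i -> f j = h j) -> P f = P g + P h.

Lemma sym_prod_slot_additive (k : nat) (A : zmodType) :
  slot_additive (@sym_prod k A).
Proof.
move=> i f g h fi fg fh; rewrite /sym_prod -raddfD; congr (quot_class _ _).
apply/eqP; rewrite -subr_eq0 opprD addrA /tpure -!raddfB.
exact/eqP/quot_class_rel/(TpowerRel fi fg fh).
Qed.

Lemma sym_prod_perm (k : nat) (A : zmodType) (s : 'S_k) (f : {ffun 'I_k -> A}) :
  sym_prod [ffun i => f (s i)] = sym_prod f.
Proof.
apply/eqP; rewrite -subr_eq0 /sym_prod -raddfB.
by apply/eqP/quot_class_rel/SymRel.
Qed.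

Lemma Sym_lift (k : nat) (A V : zmodType) (P : {ffun 'I_k -> A} -> V) :
    slot_additive P ->
    (forall (s : 'S_k) (f : {ffun 'I_k -> A}), P [ffun i => f (s i)] = P f) ->
  exists g : {additive Sym k A -> V}, forall f, g (sym_prod f) = P f.
Proof.
move=> PA PS.
have [|h hE] := @quot_lift _ V (@tpower_rel k A) (lin_ext P).
  move=> _ [i f f1 f2 fi ff1 ff2]; rewrite !raddfB /= !lin_extU !mulr1z.
  by rewrite (PA i f f1 f2) // -addrA -opprD subrr.
have [|g gE] := @quot_lift _ V (@sym_rel k A) h.
  by move=> _ [s f]; rewrite raddfB /= /tpure !hE /= !lin_extU !mulr1z PS subrr.
by exists g => f; rewrite /sym_prod gE /tpure hE /= lin_extU.
Qed.

(** Linear extension one slot at a time: the induction replaces, in the first l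
    slots, generators by arbitrary elements. *)
Lemma slot_additive_ext (k : nat) (V : zmodType) (P Q : {ffun 'I_k -> U} -> V) :
    slot_additive P -> slot_additive Q ->
    (forall g : {ffun 'I_k -> nat},
       P [ffun t => agen (g t)] = Q [ffun t => agen (g t)]) ->
  P =1 Q.
Proof.
move=> PA QA PQ.
suff H l : (l <= k)%N -> forall f : {ffun 'I_k -> U},
    (forall t : 'I_k, (l <= t)%N -> exists i, f t = agen i) -> P f = Q f.
  by move=> f; apply: (H k) => // t; rewrite leqNgt ltn_ord.
elim: l => [_ f fgen|l IH lk f fgen].
  pose g : {ffun 'I_k -> nat} := [ffun t => projT1 (cid (fgen t (leq0n t)))].
  have -> : f = [ffun t => agen (g t)].
    by apply/ffunP => t; rewrite !ffunE; case: cid.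
  exact: PQ.
pose il := Ordinal lk.
pose upd x : {ffun 'I_k -> U} := [ffun t => if t == il then x else f t].
have updD (R : {ffun 'I_k -> U} -> V) x y :
    slot_additive R -> R (upd (x + y)) = R (upd x) + R (upd y).
  by move=> RA; apply: (RA il) => [|j /negPf jl|j /negPf jl];
    rewrite !ffunE ?eqxx ?jl.
have -> : f = upd (f il) by apply/ffunP => t; rewrite ffunE; case: eqP => // ->.
elim/malg_ind: (f il) => [|x y Hx Hy|i].
- have R0 R : slot_additive R -> R (upd 0) = 0 :> V.
    by move=> RA; apply: (addrI (R (upd 0))); rewrite -updD // !addr0.
  by rewrite !R0.
- apply: (addIr (P (upd y))); rewrite -updD // [in RHS]Hy -updD //.
  by rewrite subrK.
- apply: IH => [|t lt]; first exact: ltnW.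
  rewrite ffunE; case: eqP => [_|/eqP tl]; first by exists i.
  by apply: fgen; rewrite ltn_neqAle lt andbT eq_sym.
Qed.

(** * From polynomials to symmetric powers *)

Lemma monomM (m m' : {cmonom nat}) :
  << m >> * << m' >> = << mmul m m' >> :> Stilde.
Proof. by rewrite malgM_def fgmulUU mulr1. Qed.

(** The inverse of [piU], as [linpoly_piU] shows. *)
Definition linpoly (x : U) : Stilde := lin_ext avar x.

HB.instance Definition _ := GRing.isZmodMorphism.Build U Stilde linpoly
  (lin_ext_is_zmod_morphism avar).

Lemma linpolyD : {morph linpoly : x y / x + y}.
Proof. exact: raddfD. Qed.

Lemma linpoly_agen (i : nat) : linpoly (agen i) = avar i.
Proof. by rewrite /linpoly lin_extU. Qed.

Lemma mdeg1_ucm (m : {cmonom nat}) : mdeg m = 1 -> exists i, m = ucm i.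
Proof.
move=> m1; have [i mi] : exists i, m i != 0%N.
  apply: contrapT => H; have /eqP : m = mone.
    apply/eqP/cmP => i; rewrite cm1; apply/eqP; apply: contraT => mi.
    by case: H; exists i.
  by rewrite -mdeg_eq0 m1.
have mE : m = mmul (divcm m (ucm i)) (ucm i).
  apply/eqP/cmP => l; rewrite cmM divcmE cmU; case: eqP => [<-|_]; last first.
    by rewrite subn0 addn0.
  by rewrite subnK // lt0n.
exists i; move: m1; rewrite {1}mE mdegM mdegU addn1 => -[] /eqP.
by rewrite mdeg_eq0 => /eqP d1; rewrite mE d1 mul1m.
Qed.

Lemma linpoly_piU (u : Sgraded 1) : linpoly (piU u) = u.
Proof.
rewrite [RHS](malg_expand (fsubset_refl (msupp (u : Stilde)))).
rewrite /piU {1}/lin_ext raddf_sum big_seq [RHS]big_seq; apply: eq_bigr => m.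
rewrite -mcoeff_neq0 raddfMz.
move=> /(homogP _ _ (Sgraded_homog u)) /mdeg1_ucm[i ->].
by rewrite /= mdomU big_seq_fset1 [linpoly _]linpoly_agen.
Qed.

Lemma prod_slot_additive (k : nat) (A : zmodType) (R : comNzRingType)
    (h : {additive A -> R}) :
  slot_additive (fun f : {ffun 'I_k -> A} => \prod_t h (f t)).
Proof.
move=> i f g h' fi fg fh.
have D (e : {ffun 'I_k -> A}) : \prod_t h (e t)
    = h (e i) * \prod_(t | t != i) h (e t) by rewrite (bigD1 i).
rewrite !D fi raddfD mulrDl.
by congr (_ * _ + _ * _); apply: eq_bigr => j ji; [rewrite fg|rewrite fh].
Qed.

Definition monom_of (k : nat) (f : {ffun 'I_k -> nat}) : {cmonom nat} :=
  \big[mmul/mone]_t ucm (f t).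

Lemma monom_ofE (k : nat) (f : {ffun 'I_k -> nat}) :
  << monom_of f >> = \prod_t avar (f t) :> Stilde.
Proof.
rewrite /monom_of; elim/big_rec2: _ => [//|t m y _ <-].
by rewrite monomM.
Qed.

(** The exponent of a_i counts the slots with value i, so two words with the
    same monomial are permutations of each other. *)
Lemma monom_of_perm (k : nat) (f g : {ffun 'I_k -> nat}) :
  monom_of f = monom_of g -> exists s : 'S_k, f = [ffun t => g (s t)].
Proof.
move=> fg.
have count_f (h : {ffun 'I_k -> nat}) i :
    count_mem i [tuple h t | t < k] = monom_of h i.
  rewrite /= count_map -sum1_count enumT big_mkcond /monom_of.
  elim/big_rec2: _ => [|t n m _ IH]; first by rewrite cm1.
  by rewrite cmM cmU -IH /=; case: eqP.
have /tuple_permP[s fgs] : perm_eq [tuple f t | t < k] [tuple g t | t < k].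
  by apply/allP => i _ /=; rewrite !count_f fg.
exists s; apply/ffunP => t; rewrite ffunE.
have /(congr1 (fun w => tnth w t)) : [tuple f t | t < k]
   = [tuple tnth [tuple g t | t < k] (s t) | t < k] by exact: val_inj.
by rewrite !tnth_mktuple.
Qed.

(** A monomial of degree k goes to the product of its variables in Sym^k(U),
    taken in the order of an arbitrarily chosen word; by [monom_of_perm] and
    [sym_prod_perm] the choice is irrelevant.  The other degrees go to 0. *)
Definition sym_class (k : nat) (p : Stilde) : Sym k U :=
  lin_ext (fun m : {cmonom nat} =>
    if pselect (exists f : {ffun 'I_k -> nat}, m = monom_of f) is left mf
    then sym_prod [ffun t => agen (projT1 (cid mf) t)] else 0) p.

HB.instance Definition _ (k : nat) :=
  GRing.isZmodMorphism.Build Stilde (Sym k U) (@sym_class k)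
    (lin_ext_is_zmod_morphism _).

(** Both sides are additive in each slot, so it suffices to compare them on
    generators, where the left one is the class of a monomial. *)
Lemma sym_class_prod (k : nat) (f : {ffun 'I_k -> U}) :
  sym_class k (\prod_t linpoly (f t)) = sym_prod f.
Proof.
pose P (f : {ffun 'I_k -> U}) := sym_class k (\prod_t linpoly (f t)).
apply: (@slot_additive_ext _ _ P (@sym_prod k U)).
- move=> i g h h' gi gh gh'; rewrite /P -raddfD.
  by congr sym_class; exact: (prod_slot_additive linpoly gi gh gh').
- exact: sym_prod_slot_additive.
move=> g; rewrite /P; under eq_bigr do rewrite ffunE linpoly_agen.
rewrite -monom_ofE /sym_class lin_extU mulr1z.
case: pselect => [mf|[]]; last by exists g.
case: (cid mf) => h /= /monom_of_perm[s gh].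
rewrite -(sym_prod_perm s); congr sym_prod; apply/ffunP => t.
by rewrite gh !ffunE.
Qed.

Lemma sym_class_exp (k : nat) (x : U) :
  sym_class k (linpoly x ^+ k) = sym_pow x k.
Proof.
rewrite /sym_pow -sym_class_prod; under [in RHS]eq_bigr do rewrite ffunE.
by rewrite prodr_const card_ord.
Qed.

(** * Differential calculus *)

HB.instance Definition _ := GRing.isZmodMorphism.Build Stilde Omega1 dform
  (lin_ext_is_zmod_morphism dmonom).

Lemma dformD : {morph dform : x y / x + y}.
Proof. exact: raddfD. Qed.

Definition pderiv (j : nat) (f : Stilde) : Stilde := (dform f)@_j.

Fact pderiv_is_zmod_morphism (j : nat) : zmod_morphism (pderiv j).
Proof. by move=> f g; rewrite /pderiv !raddfB. Qed.

HB.instance Definition _ (j : nat) :=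
  GRing.isZmodMorphism.Build Stilde Stilde (pderiv j)
    (pderiv_is_zmod_morphism j).

Lemma pderiv_monom (j : nat) (m : {cmonom nat}) :
  pderiv j << m >> = << (m j)%:Z *g divcm m (ucm j) >>.
Proof.
rewrite /pderiv /dform lin_extU mulr1z /dmonom raddf_sum /=.
have E i : ((<< (m i)%:Z *g divcm m (ucm i) >> : Stilde) *: da i)@_j
    = if i == j then << (m j)%:Z *g divcm m (ucm j) >> else 0.
  rewrite mcoeffZ /da mcoeffU.
  by have [->|_] := eqVneq i j; [rewrite mulr1 | exact: mulr0].
under eq_bigr do rewrite E.
have [jm|jm] := boolP (j \in finsupp m).
  rewrite (big_fsetD1 j) //= eqxx big_seq big1 ?addr0 // => i.
  by rewrite !inE => /andP[/negPf -> _].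
rewrite big_seq big1 => [|i im]; last first.
  by case: eqP => [ij|] //; rewrite -ij im in jm.
by move: jm; rewrite -cmE_eq0 => /eqP ->; rewrite monalgU0.
Qed.

(** The rule is a relation between two given elements so that it can be
    propagated from generators. *)
Definition leibniz (R : comNzRingType) (D : {additive R -> R})
    (x y : R) : Prop :=
  D (x * y) = D x * y + x * D y.

Lemma leibnizC (R : comNzRingType) (D : {additive R -> R}) (x y : R) :
  leibniz D x y -> leibniz D y x.
Proof. by rewrite /leibniz mulrC => ->; ring. Qed.

Lemma leibniz0 (R : comNzRingType) (D : {additive R -> R}) (y : R) :
  leibniz D 0 y.
Proof. by rewrite /leibniz mul0r raddf0 !mul0r addr0. Qed.

Lemma leibnizB (R : comNzRingType) (D : {additive R -> R}) (x x' y : R) :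
  leibniz D x y -> leibniz D x' y -> leibniz D (x - x') y.
Proof. by rewrite /leibniz mulrBl !raddfB /= => -> ->; ring. Qed.

Lemma leibnizX (R : comNzRingType) (D : {additive R -> R})
    (DM : forall x y, leibniz D x y) (k : nat) (f : R) :
  D (f ^+ k.+1) = f ^+ k * D f *+ k.+1.
Proof.
elim: k => [|k IH]; first by rewrite expr1 mul1r.
by rewrite exprS DM IH [in RHS]mulrS exprS; ring.
Qed.

Lemma leibniz_int (R : comNzRingType) (D : {additive R -> R})
    (DM : forall x y, leibniz D x y) (c : int) :
  D c%:~R = 0.
Proof.
suff D1 : D 1 = 0 by rewrite raddfMz D1 mul0rz.
apply: (addIr (D 1)).
by have := DM 1 1; rewrite /leibniz !mulr1 mul1r add0r => /esym.
Qed.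

Lemma pderiv_monomMl (j : nat) (a b : {cmonom nat}) :
  pderiv j << a >> * << b >>
    = << (a j)%:Z *g divcm (mmul a b) (ucm j) >> :> Stilde.
Proof.
rewrite pderiv_monom malgM_def fgmulUU mulr1.
(* If the j-th variable does not divide a, then dividing by it before or after
   multiplying by b may give different monomials, but their coefficient is 0. *)
have [->|aj] := eqVneq (a j) 0%N; first by rewrite !monalgU0.
suff -> : mmul (divcm a (ucm j)) b = divcm (mmul a b) (ucm j) by [].
apply/eqP/cmP => i; rewrite cmM !divcmE cmM cmU.
by case: eqP => [<-|_]; rewrite ?subn0 // addnBAC // lt0n.
Qed.

Lemma pderiv_mmul (j : nat) (a b : {cmonom nat}) :
  pderiv j (<< a >> * << b >>)
    = << (a j)%:Z *g divcm (mmul a b) (ucm j) >>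
      + << (b j)%:Z *g divcm (mmul a b) (ucm j) >>.
Proof.
by rewrite [X in pderiv j X]monomM pderiv_monom cmM PoszD monalgUD.
Qed.

Lemma pderiv_monom_leibniz (j : nat) (a b : {cmonom nat}) :
  leibniz (pderiv j) (<< a >> : Stilde) (<< b >> : Stilde).
Proof.
apply: (etrans (pderiv_mmul j a b)).
have mulbE := pderiv_monomMl j b a.
rewrite mulrC mulmC in mulbE.
exact (esym (congr2 +%R (pderiv_monomMl j a b) mulbE)).
Qed.

Lemma pderiv_leibniz (j : nat) (f g : Stilde) : leibniz (pderiv j) f g.
Proof.
apply: (malg_ind (P := (leibniz (pderiv j))^~ g)) => [|f1 f2|m].
- exact: leibniz0.
- exact: leibnizB.
apply/leibnizC.
apply: (malg_ind (P := (leibniz (pderiv j))^~ _)) => [|g1 g2|m'].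
- exact: leibniz0.
- exact: leibnizB.
- exact: pderiv_monom_leibniz.
Qed.

Lemma pderiv_linpoly (j : nat) (x : U) : pderiv j (linpoly x) = (x@_j)%:~R.
Proof.
apply: (malg_ext (f := pderiv j \o linpoly)
  (g := (intmul 1 : int -> Stilde) \o mcoeff j)) => i.
rewrite /= [linpoly _]linpoly_agen /pderiv dform_avar /da !mcoeffU.
by case: eqP.
Qed.

(** The identity d (u^N (u dv - v du)) = (N + 2) u^N du ∧ dv in coordinates: D
    and E stand for two partial derivatives, and u and v for linear polynomials. *)
Lemma leibniz_curl (R : comNzRingType) (D E : {additive R -> R})
    (DM : forall x y, leibniz D x y) (EM : forall x y, leibniz E x y)
    (N : nat) (u v : R) (du dv eu ev : int) :
    D u = du%:~R -> D v = dv%:~R -> E u = eu%:~R -> E v = ev%:~R ->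
  D (u ^+ N * (u * E v - v * E u)) - E (u ^+ N * (u * D v - v * D u))
    = u ^+ N *~ (du * ev - eu * dv) *+ N.+2.
Proof.
move=> Du Dv Eu Ev; rewrite Du Dv Eu Ev.
have DP (F : {additive R -> R}) (FM : forall x y, leibniz F x y)
    (fu fv a b : int) :
    F u = fu%:~R -> F v = fv%:~R ->
    F (u ^+ N * (u * a%:~R - v * b%:~R))
      = N%:R * u ^+ N.-1 * fu%:~R * (u * a%:~R - v * b%:~R)
        + u ^+ N * (fu%:~R * a%:~R - fv%:~R * b%:~R).
  move=> Fu Fv; rewrite FM raddfB !FM !(leibniz_int FM) Fu Fv !mulr0 !addr0.
  (* For N = 0 the exponent N.-1 is truncated, but its coefficient N is 0. *)
  congr (_ * _ + _); case: (N) => [|m].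
    by rewrite !mul0r (leibniz_int FM 1).
  by rewrite (leibnizX FM) Fu -mulr_natl mulrA.
rewrite (DP _ DM _ _ _ _ Du Dv) (DP _ EM _ _ _ _ Eu Ev).
rewrite -[u ^+ N *~ _]mulrzr -[RHS]mulr_natr intrB !intrM.
case: (N) => [|m] /=; first by ring.
by rewrite exprS; ring.
Qed.

(** The coefficient of da_j ∧ da_k in the exterior derivative. *)
Definition curl (j k : nat) (o : Omega1) : Stilde :=
  pderiv j o@_k - pderiv k o@_j.

Fact curl_is_zmod_morphism (j k : nat) : zmod_morphism (curl j k).
Proof. by move=> o o'; rewrite /curl !raddfB addrACA. Qed.

HB.instance Definition _ (j k : nat) :=
  GRing.isZmodMorphism.Build Omega1 Stilde (curl j k)
    (curl_is_zmod_morphism j k).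

Lemma wterm_coord (n : nat) (f g : Stilde) (l : nat) :
  (wterm n f g)@_l = f ^+ (n - 2) * (f * pderiv l g - g * pderiv l f).
Proof.
rewrite /wterm [LHS]mcoeffZ mcoeffB [X in X - _]mcoeffZ [X in _ - X]mcoeffZ.
reflexivity.
Qed.

Lemma curl_wterm (n : nat) (x y : U) (j k : nat) : (2 <= n)%N ->
  curl j k (wterm n (linpoly x) (linpoly y))
    = linpoly x ^+ (n - 2) *~ (x@_j * y@_k - x@_k * y@_j) *+ n.
Proof.
move=> n2; rewrite /curl !wterm_coord.
have := leibniz_curl (pderiv_leibniz j) (pderiv_leibniz k) (n - 2)
  (pderiv_linpoly j x) (pderiv_linpoly j y)
  (pderiv_linpoly k x) (pderiv_linpoly k y).
have -> : (n - 2).+2 = n by rewrite -addn2 subnK.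
exact: id.
Qed.

(** * Recovering twice an element from its coordinates *)

Lemma wedge_expand (d : {fset nat}) (x y : U) :
    (msupp x `<=` d)%fset -> (msupp y `<=` d)%fset ->
  x ∧ y = \sum_(j <- d) \sum_(k <- d) (agen j ∧ agen k) *~ (x@_j * y@_k).
Proof.
move=> xd yd; rewrite {1}(malg_expand xd) -/(wedgel y _) raddf_sum.
apply: eq_bigr => j _; rewrite raddfMz /= /wedgel {1}(malg_expand yd) raddf_sum.
rewrite mulrz_suml; apply: eq_bigr => k _; rewrite raddfMz /=.
by rewrite -mulrzA mulrC.
Qed.

(** Subtract from the expansion of x ∧ y that of y ∧ x = - (x ∧ y). *)
Lemma wedge_mul2 (d : {fset nat}) (x y : U) :
    (msupp x `<=` d)%fset -> (msupp y `<=` d)%fset ->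
  (x ∧ y) *+ 2 = \sum_(j <- d) \sum_(k <- d)
    (agen j ∧ agen k) *~ (x@_j * y@_k - x@_k * y@_j).
Proof.
move=> xd yd; rewrite mulr2n -{2}[x ∧ y]opprK -wedgeC.
rewrite {1}(wedge_expand xd yd) (wedge_expand yd xd) -sumrB.
apply: eq_bigr => j _; rewrite -sumrB; apply: eq_bigr => k _.
by rewrite mulrzBr [y@_j * _]mulrC.
Qed.

Lemma minors_eq0 (n M : nat) (r : 'I_M -> int) (x y : 'I_M -> U) (j k : nat) :
    (2 <= n)%N ->
    \sum_(i < M) wterm n (linpoly (x i)) (linpoly (y i)) *~ r i = 0 ->
  \sum_(i < M) linpoly (x i) ^+ (n - 2)
    *~ ((x i)@_j * (y i)@_k - (x i)@_k * (y i)@_j) *~ r i = 0.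
Proof.
move=> n2 w0; apply: (Stilde_mulrn_eq0 (ltnW n2)).
rewrite -sumrMnl -[RHS](raddf0 (curl j k)) -w0 raddf_sum.
apply: eq_bigr => i _; rewrite raddfMz /=.
rewrite (curl_wterm _ _ _ _ n2).
by rewrite [LHS]pmulrn; apply: mulrzAC.
Qed.

Lemma wedge_sym_mul2_eq0 (n M : nat) (r : 'I_M -> int) (x y : 'I_M -> U) :
    (2 <= n)%N ->
    \sum_(i < M) wterm n (linpoly (x i)) (linpoly (y i)) *~ r i = 0 ->
  (\sum_(i < M) ((x i ∧ y i) ⊗ sym_pow (x i) (n - 2)) *~ r i) *+ 2 = 0.
Proof.
move=> n2 w0.
pose d : {fset nat} := (\bigcup_(i in 'I_M) (msupp (x i) `|` msupp (y i)))%fset.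
have sd i : (msupp (x i) `|` msupp (y i) `<=` d)%fset by exact: bigfcup_sup.
have xd i : (msupp (x i) `<=` d)%fset.
  exact: fsubset_trans (fsubsetUl _ _) (sd i).
have yd i : (msupp (y i) `<=` d)%fset.
  exact: fsubset_trans (fsubsetUr _ _) (sd i).
pose minor i j k := (x i)@_j * (y i)@_k - (x i)@_k * (y i)@_j.
pose term i j k :=
  (agen j ∧ agen k) ⊗ sym_pow (x i) (n - 2) *~ minor i j k *~ r i.
have coord0 j k : \sum_(i < M) term i j k = 0.
  have E : (agen j ∧ agen k) ⊗ sym_class (n - 2) (\sum_(i < M)
      linpoly (x i) ^+ (n - 2) *~ minor i j k *~ r i) = \sum_(i < M) term i j k.
    rewrite (raddf_sum (@sym_class (n - 2))) (raddf_sum (tens _)).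
    apply: eq_bigr => i _.
    by rewrite !raddfMz /= sym_class_exp.
  by rewrite -E (minors_eq0 j k n2 w0) !raddf0.
have termE i : ((x i ∧ y i) ⊗ sym_pow (x i) (n - 2)) *~ r i *+ 2
    = \sum_(j <- d) \sum_(k <- d) term i j k.
  rewrite [LHS]pmulrn [LHS]mulrzAC -[_ ⊗ _]/(tensl _ _) -pmulrn -raddfMn.
  rewrite (wedge_mul2 (xd i) (yd i)) raddf_sum mulrz_suml.
  apply: eq_bigr => j _; rewrite raddf_sum mulrz_suml; apply: eq_bigr => k _.
  by rewrite raddfMz.
rewrite -sumrMnl; under eq_bigr do rewrite termE.
by rewrite exchange_big big1 // => j _; rewrite exchange_big big1.
Qed.

(** * From tensors to 1-forms *)

(** The map is the Koszul differential (x ∧ y) ⊗ s |-> s (x dy - y dx). *)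
Lemma koszul_map (n : nat) :
  exists g : {additive tensor (wedge2 U) (Sym (n - 2) U) -> Omega1},
    forall x y, g ((x ∧ y) ⊗ sym_pow x (n - 2))
      = wterm n (linpoly x) (linpoly y).
Proof.
have [s sE] : exists s : {additive Sym (n - 2) U -> Stilde},
    forall f : {ffun 'I_(n - 2) -> U}, s (sym_prod f) = \prod_t linpoly (f t).
  apply: Sym_lift => [|p f]; first exact: (prod_slot_additive linpoly).
  rewrite [RHS](reindex_inj (@perm_inj _ p)).
  by apply: eq_bigr => t _; rewrite ffunE.
pose b (x y : U) : Omega1 :=
  linpoly x *: dform (linpoly y) - linpoly y *: dform (linpoly x).
have bDl y : {morph b^~ y : x x' / x + x'}.
  move=> x x' /=; rewrite /b linpolyD dformD scalerDl scalerDr.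
  by rewrite opprD addrACA.
have [|w wE] := wedge2_lift bDl; first by move=> x y; rewrite /b opprB.
have [t|t|g gE] := @tensor_lift _ _ _ (fun o p => s p *: w o).
- by move=> o o'; rewrite raddfD scalerDr.
- by move=> p p'; rewrite raddfD scalerDl.
exists g => x y; rewrite gE wE /sym_pow sE /b /wterm.
under eq_bigr do rewrite ffunE.
by rewrite prodr_const card_ord.
Qed.

(** * The criterion *)

Lemma order_1_or_2 (V : zmodType) (x : V) :
  has_order x 1 \/ has_order x 2 <-> x *+ 2 = 0.
Proof.
split=> [[[_ x0 _]|[_ //]]|x2]; first by rewrite -(mulr1n x) x0 mul0rn.
have [x0|/eqP x0] := eqVneq x 0; [left|right]; split=> //.
- by case.
- by case=> [|[|]].
Qed.

Theorem proposition3p10 (n : nat) (hn : (2 <= n)%N)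
    (M : nat) (r : 'I_M -> int) (u v : 'I_M -> Sgraded 1)
    (alpha : {malg (Sgraded 1 * Sgraded 1)%type})
    (alphaE : alpha = \sum_(i < M) << r i *g (u i, v i) >>) :
  let z := fun i => piU (u i) in
  let w := fun i => piU (v i) in
  let A : tensor (wedge2 U) (Sym (n - 2) U) :=
    \sum_(i < M) ((z i ∧ w i) ⊗ sym_pow (z i) (n - 2)) *~ r i in
  wform hn alpha = 0 <-> has_order A 1 \/ has_order A 2.
Proof.
move=> z w A; rewrite order_1_or_2.
pose o := \sum_(i < M) wterm n (linpoly (z i)) (linpoly (w i)) *~ r i.
have wE : wform hn alpha = o :> Omega1.
  rewrite alphaE wformE; apply: eq_bigr => i _.
  by rewrite /z /w !linpoly_piU.
split=> [w0|A2].
  by apply: wedge_sym_mul2_eq0 => //; rewrite -/o -wE w0.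
apply: val_inj; apply: (etrans wE).
have [g gE] := koszul_map n.
have gA : g A = o.
  rewrite raddf_sum; apply: eq_bigr => i _.
  by rewrite raddfMz gE.
by apply: (@Omega1_mulrn_eq0 2) => //; rewrite -gA -raddfMn A2 raddf0.
Qed.
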